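(* For all $d,d'>0$, $T_{\rm rel}(\lfloor d/q\rfloor)\asymp T_{\rm rel}(\lfloor d'/q\rfloor)$ as $q\downarrow0$. In particular, for all $d'>d>0$, $$\lim_{q\downarrow0}\Big(\frac{T_{\rm rel}(\lfloor d'/q\rfloor)}{T_{\rm rel}(\lfloor d/q\rfloor)}\Big)^{1/\log(1/q)}=1.$$
   Context: Fix $q\in(0,1/2)$, $p=1-q$. $T_{\rm rel}(L)$ denotes the relaxation time (inverse spectral gap) of the East process on $\Lambda=\{1,\dots,L\}$: the Markov chain on $\{0,1\}^\Lambda$ with generator $\mathcal L f(\sigma)=\sum_{x\in\Lambda}c_x(\sigma)[\pi_x(f)-f](\sigma)$, $c_1\equiv1$, $c_x(\sigma)=1-\sigma_{x-1}$ for $x\ge2$, where $\pi_x(f)$ averages $f$ over $\sigma_x\sim$ Bernoulli$(p)$; the gap is $\inf_f \sum_x\pi(c_x\mathrm{Var}_x f)/\mathrm{Var}_\pi(f)$ with $\pi$ the product Bernoulli$(p)$ measure. For positive $f,h$, $f\asymp h$ means $0<\liminf_{q\downarrow0}f/h\le\limsup_{q\downarrow0}f/h<\infty$. *)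

(* Defs.v *)
From Stdlib Require Import Reals Lra List ZArith ClassicalEpsilon.
Import ListNotations.
Open Scope R_scope.

(* A configuration on Lambda = {1,...,L} is a list of L booleans;
   site x (1-based) is the entry of index x-1. true = occupied (sigma_x = 1). *)
Fixpoint configs (L : nat) : list (list bool) :=
  match L with
  | O => (nil : list bool) :: nil
  | S n => flat_map (fun s => [false :: s; true :: s]) (configs n)
  end.

Definition sumR (l : list R) : R := fold_right Rplus 0%R l.

Definition weight (p : R) (s : list bool) : R :=
  fold_right (fun (b : bool) (acc : R) => (if b then p else 1 - p) * acc) 1 s.

Definition piE (L : nat) (q : R) (f : list bool -> R) : R :=
  sumR (map (fun s => weight (1 - q) s * f s) (configs L)).

Definition piVar (L : nat) (q : R) (f : list bool -> R) : R :=
  piE L q (fun s => f s * f s) - piE L q f * piE L q f.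

Fixpoint upd (s : list bool) (i : nat) (b : bool) : list bool :=
  match s, i with
  | [], _ => []
  | _ :: t, O => b :: t
  | a :: t, S j => a :: upd t j b
  end.

Definition piX (q : R) (i : nat) (f : list bool -> R) (s : list bool) : R :=
  (1 - q) * f (upd s i true) + q * f (upd s i false).

Definition VarX (q : R) (i : nat) (f : list bool -> R) (s : list bool) : R :=
  piX q i (fun t => f t * f t) s - piX q i f s * piX q i f s.

(* East constraint at site x = i+1: c_1 = 1, c_x = 1 - sigma_{x-1} *)
Definition cX (i : nat) (s : list bool) : R :=
  match i with
  | O => 1
  | S j => if nth j s false then 0 else 1
  end.

Definition Dir (L : nat) (q : R) (f : list bool -> R) : R :=
  sumR (map (fun i => piE L q (fun s => cX i s * VarX q i f s)) (seq 0 L)).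

Definition is_glb (E : R -> Prop) (g : R) : Prop :=
  (forall r, E r -> g <= r) /\ (forall b, (forall r, E r -> b <= r) -> b <= g).

Definition gap_set (L : nat) (q : R) (r : R) : Prop :=
  exists f : list bool -> R, 0 < piVar L q f /\ r = Dir L q f / piVar L q f.

Definition gap (L : nat) (q : R) : R :=
  epsilon (inhabits 0) (fun g => is_glb (gap_set L q) g).

Definition Trel (L : nat) (q : R) : R := 1 / gap L q.

(* floor(x) as a natural number (for x >= 0); Int_part is the floor *)
Definition nfloor (x : R) : nat := Z.to_nat (Int_part x).

(* Main.v *)
(** Put [K = 4 / (1 - (1-q)^k)].  Split the volume into two blocks, the first
    of length [a + k] and the second of length [l].  With probability
    [1 - (1-q)^k] the last [k] sites of the first block contain a zero; given
    that event, the East chain on the sites to the right of the leftmost such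
    zero relaxes the second block in time [Trel (k + l)].  Resampling the first
    block freely and the second one only under that event is a chain whose
    relaxation time is at most of order [K], so that
    [Trel (a + k + l) <= K * max (Trel (a + k)) (Trel (k + l))].
    When [k] is of order [1/q], [K] is bounded uniformly in [q], and [Trel (d'/q)]
    is reached from [Trel (d/q)] in a number of such steps independent of [q]. *)

Require Import Defs.
From Stdlib Require Import Reals Lra Lia List ZArith ClassicalEpsilon.
Import ListNotations.
Open Scope R_scope.

(** * Product expectation and East Dirichlet form by recursion on the volume *)

Fixpoint expect (q : R) (n : nat) (f : list bool -> R) : R :=
  match n with
  | O => f []
  | S m => q * expect q m (fun s => f (false :: s))
           + (1 - q) * expect q m (fun s => f (true :: s))
  end.

Definition variance (q : R) (n : nat) (f : list bool -> R) : R :=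
  expect q n (fun s => f s * f s) - expect q n f * expect q n f.

(* [c] is the value of the constraint at the leftmost site; the recursion passes
   to the next site the constraint imposed by the current one. *)
Fixpoint dirichlet (q : R) (n : nat) (c : R) (f : list bool -> R) : R :=
  match n with
  | O => 0
  | S m =>
      c * (q * (1 - q)) *
        expect q m (fun s => (f (true :: s) - f (false :: s)) *
                             (f (true :: s) - f (false :: s)))
      + q * dirichlet q m 1 (fun s => f (false :: s))
      + (1 - q) * dirichlet q m 0 (fun s => f (true :: s))
  end.

Lemma expect_ext q n f g : (forall s, f s = g s) -> expect q n f = expect q n g.
Proof.
  revert f g; induction n as [|n IH]; intros f g H; simpl; [apply H|].
  rewrite (IH (fun s => f (false :: s)) (fun s => g (false :: s))) by (intro; apply H).
  rewrite (IH (fun s => f (true :: s)) (fun s => g (true :: s))) by (intro; apply H).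
  reflexivity.
Qed.

Lemma expect_lin q n a b f g :
  expect q n (fun s => a * f s + b * g s) = a * expect q n f + b * expect q n g.
Proof.
  revert f g; induction n as [|n IH]; intros f g; simpl; [reflexivity|].
  rewrite (IH (fun s => f (false :: s)) (fun s => g (false :: s))).
  rewrite (IH (fun s => f (true :: s)) (fun s => g (true :: s))). ring.
Qed.

Lemma expect_const q n a : expect q n (fun _ => a) = a.
Proof. induction n as [|n IH]; simpl; [reflexivity|rewrite IH; ring]. Qed.

Lemma expect_plus q n f g :
  expect q n (fun s => f s + g s) = expect q n f + expect q n g.
Proof.
  rewrite (expect_ext q n _ (fun s => 1 * f s + 1 * g s)) by (intro; ring).
  rewrite expect_lin; ring.
Qed.

Lemma expect_minus q n f g :
  expect q n (fun s => f s - g s) = expect q n f - expect q n g.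
Proof.
  rewrite (expect_ext q n _ (fun s => 1 * f s + (-1) * g s)) by (intro; ring).
  rewrite expect_lin; ring.
Qed.

Lemma expect_scal q n a f : expect q n (fun s => a * f s) = a * expect q n f.
Proof.
  rewrite (expect_ext q n _ (fun s => a * f s + 0 * f s)) by (intro; ring).
  rewrite expect_lin; ring.
Qed.

Lemma expect_app q m n f :
  expect q (m + n) f = expect q m (fun s => expect q n (fun t => f (s ++ t))).
Proof.
  revert f; induction m as [|m IH]; intro f; simpl; [reflexivity|].
  now rewrite !IH.
Qed.

Lemma expect_swap q m n F :
  expect q m (fun s => expect q n (fun t => F s t))
  = expect q n (fun t => expect q m (fun s => F s t)).
Proof.
  revert F; induction m as [|m IH]; intro F; simpl; [reflexivity|].
  rewrite (IH (fun s t => F (false :: s) t)), (IH (fun s t => F (true :: s) t)).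
  symmetry; apply expect_lin.
Qed.

Lemma expect_firstn q n m f :
  expect q (n + m) (fun s => f (firstn n s)) = expect q n f.
Proof.
  revert f; induction n as [|n IH]; intro f; simpl; [apply expect_const|].
  rewrite (IH (fun s => f (false :: s))), (IH (fun s => f (true :: s))). reflexivity.
Qed.

(** * Inequalities for the product measure and monotonicity of the Dirichlet form *)

Section Positivity.

Variable q : R.
Hypothesis Hq : 0 < q < 1.

Lemma expect_nonneg n f : (forall s, 0 <= f s) -> 0 <= expect q n f.
Proof.
  revert f; induction n as [|n IH]; intros f H; simpl; [apply H|].
  pose proof (IH (fun s => f (false :: s)) (fun s => H _)).
  pose proof (IH (fun s => f (true :: s)) (fun s => H _)). nra.
Qed.

Lemma expect_le n f g : (forall s, f s <= g s) -> expect q n f <= expect q n g.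
Proof.
  intro H. pose proof (expect_nonneg n (fun s => g s - f s)) as H0.
  rewrite expect_minus in H0.
  assert (forall s, 0 <= g s - f s) by (intro s; specialize (H s); lra).
  specialize (H0 H1); lra.
Qed.

Lemma expect_cauchy_schwarz n u v :
  expect q n (fun s => u s * v s) * expect q n (fun s => u s * v s)
  <= expect q n (fun s => u s * u s) * expect q n (fun s => v s * v s).
Proof.
  set (X := expect q n (fun s => u s * u s)).
  set (Y := expect q n (fun s => u s * v s)).
  set (Z := expect q n (fun s => v s * v s)).
  assert (H : forall a b, 0 <= a * a * X + 2 * a * b * Y + b * b * Z).
  { intros a b.
    replace (a * a * X + 2 * a * b * Y + b * b * Z)
      with (expect q n (fun s => (a * u s + b * v s) * (a * u s + b * v s))).
    - apply expect_nonneg; intro; apply Rle_0_sqr.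
    - rewrite (expect_ext q n _ (fun s => (a * a) * (u s * u s) +
                 1 * ((2 * a * b) * (u s * v s) + (b * b) * (v s * v s))))
        by (intro; ring).
      rewrite !expect_lin. unfold X, Y, Z. ring. }
  assert (HX : 0 <= X) by (apply expect_nonneg; intro; apply Rle_0_sqr).
  assert (HZ : 0 <= Z) by (apply expect_nonneg; intro; apply Rle_0_sqr).
  (* The directions [(Y, -X)] and [(Z, -Y)] give the claim multiplied by [X] and by [Z]; if both
     vanish, [(1, 1)] and [(1, -1)] force [Y = 0]. *)
  pose proof (H Y (- X)). pose proof (H Z (- Y)).
  pose proof (H 1 1). pose proof (H 1 (-1)).
  destruct (Rle_lt_or_eq_dec 0 X HX); [nra|].
  destruct (Rle_lt_or_eq_dec 0 Z HZ); [nra|].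
  assert (Y = 0) by lra. nra.
Qed.

Lemma expect_sqr_le n f :
  expect q n f * expect q n f <= expect q n (fun s => f s * f s).
Proof.
  pose proof (expect_cauchy_schwarz n f (fun _ => 1)) as H. simpl in H.
  rewrite (expect_ext q n (fun s => f s * 1) f) in H by (intro; ring).
  rewrite expect_const in H. lra.
Qed.

Lemma variance_nonneg n f : 0 <= variance q n f.
Proof. unfold variance; pose proof (expect_sqr_le n f); lra. Qed.

Lemma variance_centered n f :
  variance q n f
  = expect q n (fun s => (f s - expect q n f) * (f s - expect q n f)).
Proof.
  unfold variance. set (m := expect q n f).
  rewrite (expect_ext q n (fun s => (f s - m) * (f s - m))
             (fun s => 1 * (f s * f s) + 1 * ((- 2 * m) * f s + (m * m) * 1)))
    by (intro; ring).
  rewrite !expect_lin, expect_const. fold m. ring.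
Qed.

Lemma variance_plus_le n f g :
  variance q n (fun s => f s + g s) <= 2 * variance q n f + 2 * variance q n g.
Proof.
  rewrite !variance_centered, expect_plus, <- expect_lin.
  apply expect_le; intro s. set (a := f s - expect q n f). set (b := g s - expect q n g).
  replace (f s + g s - (expect q n f + expect q n g)) with (a + b) by (unfold a, b; ring).
  pose proof (Rle_0_sqr (a - b)); unfold Rsqr in *; lra.
Qed.

Lemma variance_scal n a f :
  variance q n (fun s => a * f s) = a * a * variance q n f.
Proof.
  unfold variance. rewrite expect_scal.
  rewrite (expect_ext q n _ (fun s => (a * a) * (f s * f s))) by (intro; ring).
  rewrite expect_scal. ring.
Qed.

(** By the total variance formula, the difference of the two sides is the variance over the first
    [k] sites of the conditional mean. *)
Lemma variance_app_le k l f :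
  expect q k (fun s => variance q l (fun t => f (s ++ t))) <= variance q (k + l) f.
Proof.
  unfold variance at 2. rewrite !expect_app. unfold variance. rewrite expect_minus.
  pose proof (expect_sqr_le k (fun s => expect q l (fun t => f (s ++ t)))). simpl in *. lra.
Qed.

Lemma dirichlet_nonneg n c f : 0 <= c -> 0 <= dirichlet q n c f.
Proof.
  revert c f; induction n as [|n IH]; intros c f Hc; simpl; [lra|].
  pose proof (IH 1 (fun s => f (false :: s)) ltac:(lra)).
  pose proof (IH 0 (fun s => f (true :: s)) ltac:(lra)).
  pose proof (expect_nonneg n (fun s => (f (true :: s) - f (false :: s)) *
                             (f (true :: s) - f (false :: s)))
               (fun s => Rle_0_sqr _)) as H1.
  assert (0 <= c * (q * (1 - q))) by (apply Rmult_le_pos; [|apply Rmult_le_pos]; lra).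
  pose proof (Rmult_le_pos _ _ H2 H1). nra.
Qed.

Lemma dirichlet_const n c a : dirichlet q n c (fun _ => a) = 0.
Proof.
  revert c; induction n as [|n IH]; intro c; simpl; [reflexivity|].
  rewrite !IH, expect_const. ring.
Qed.

(** Constraints look only to the left, so the sites beyond the [n]-th do not influence those of the
    first [n], and their own terms vanish for such a function. *)
Lemma dirichlet_firstn n m c f :
  dirichlet q (n + m) c (fun s => f (firstn n s)) = dirichlet q n c f.
Proof.
  revert c f; induction n as [|n IH]; intros c f; simpl; [apply dirichlet_const|].
  rewrite (IH _ (fun s => f (false :: s))), (IH _ (fun s => f (true :: s))).
  rewrite (expect_firstn q n m (fun s => (f (true :: s) - f (false :: s)) *
                             (f (true :: s) - f (false :: s)))).
  reflexivity.
Qed.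

(** Freezing the right end [t] leaves the constraints of the first [m] sites unchanged; what is lost
    is the nonnegative contribution of the last [l] sites. *)
Lemma dirichlet_prefix_le m l c f : 0 <= c ->
  expect q l (fun t => dirichlet q m c (fun s => f (s ++ t))) <= dirichlet q (m + l) c f.
Proof.
  revert c f; induction m as [|m IH]; intros c f Hc; simpl.
  - rewrite expect_const. now apply dirichlet_nonneg.
  - rewrite !expect_plus, !expect_scal.
    rewrite <- expect_swap.
    pose proof (IH 1 (fun s => f (false :: s)) ltac:(lra)) as H1.
    pose proof (IH 0 (fun s => f (true :: s)) ltac:(lra)) as H2. simpl in H1, H2.
    rewrite expect_app.
    apply Rplus_le_compat; [apply Rplus_le_compat|];
      [apply Rle_refl | apply Rmult_le_compat_l; lra ..].
Qed.

(** * The two-block inequality *)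

(* The variance of the block-2 function [E_1 f] is compared with that of
   [E_1 (c f)]: their difference is a covariance in block 1, bounded by
   Cauchy-Schwarz, and [E_1 (c f)] only sees configurations with [c = 1]. *)
Lemma two_block_variance m l (c f : list bool -> R) :
  (forall s, c s * c s = c s) -> 0 < expect q m c ->
  expect q m c * variance q (m + l) f
  <= (2 - expect q m c) * expect q l (fun t => variance q m (fun s => f (s ++ t)))
     + 2 * expect q m (fun s => c s * variance q l (fun t => f (s ++ t))).
Proof.
  intros Hc Hp. set (P := expect q m c) in *.
  set (G := fun t => expect q m (fun s => f (s ++ t))).
  set (H := fun t => expect q m (fun s => c s * f (s ++ t))).
  set (V1 := expect q l (fun t => variance q m (fun s => f (s ++ t)))).
  set (V2 := expect q m (fun s => c s * variance q l (fun t => f (s ++ t)))).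
  assert (Hdec : variance q (m + l) f = V1 + variance q l G).
  { unfold V1, variance. rewrite !expect_app, expect_minus.
    rewrite (expect_swap q m l (fun s t => f (s ++ t) * f (s ++ t))).
    rewrite (expect_swap q m l (fun s t => f (s ++ t))). unfold G. ring. }
  (* [P * G t - H t] is minus the covariance of [c] and [f] in block 1, and [P - P * P] is the
     variance of [c]. *)
  assert (HcovF : variance q l (fun t => P * G t - H t) <= (P - P * P) * V1).
  { apply Rle_trans with (expect q l (fun t => (P * G t - H t) * (P * G t - H t))).
    - unfold variance. pose proof (Rle_0_sqr (expect q l (fun t => P * G t - H t))) as Hs.
      unfold Rsqr in Hs. lra.
    - unfold V1. rewrite <- expect_scal. apply expect_le; intro t.
      pose proof (expect_cauchy_schwarz m (fun s => c s - P) (fun s => f (s ++ t) - G t)) as CS.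
      simpl in CS.
      replace (expect q m (fun s => (f (s ++ t) - G t) * (f (s ++ t) - G t)))
        with (variance q m (fun s => f (s ++ t))) in CS by (rewrite variance_centered; reflexivity).
      replace (expect q m (fun s => (c s - P) * (c s - P))) with (P - P * P) in CS.
      2:{ pose proof (variance_centered m c) as Hvc. fold P in Hvc.
          rewrite <- Hvc. unfold variance.
          rewrite (expect_ext q m (fun s => c s * c s) c) by apply Hc. fold P. ring. }
      replace (expect q m (fun s => (c s - P) * (f (s ++ t) - G t)))
        with (H t - P * G t) in CS.
      2:{ rewrite (expect_ext q m _ (fun s => 1 * (c s * f (s ++ t)) +
                 1 * ((- P) * f (s ++ t) + (- G t) * (1 * c s + (- P) * 1)))) by (intro; ring).
          rewrite !expect_lin, expect_const. fold P. unfold H, G. ring. }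
      lra. }
  (* Since [c = c * c], Cauchy-Schwarz against [c] costs a factor [P] and keeps one [c] on the
     squared deviation of [f] from its block-2 mean [mu]. *)
  assert (HJ : variance q l H <= P * V2).
  { rewrite variance_centered.
    set (mu := fun s => expect q l (fun t => f (s ++ t))).
    assert (HM : expect q l H = expect q m (fun s => c s * mu s)).
    { unfold H. rewrite <- (expect_swap q m l (fun s t => c s * f (s ++ t))).
      apply expect_ext; intro s. apply expect_scal. }
    apply Rle_trans with
      (expect q l (fun t => P * expect q m (fun s =>
         c s * ((f (s ++ t) - mu s) * (f (s ++ t) - mu s))))).
    - apply expect_le; intro t. rewrite HM. unfold H at 1 2. rewrite <- expect_minus.
      pose proof (expect_cauchy_schwarz m c (fun s => c s * (f (s ++ t) - mu s))) as CS.
      simpl in CS.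
      rewrite (expect_ext q m (fun s => c s * c s) c) in CS by apply Hc. fold P in CS.
      rewrite (expect_ext q m (fun s => c s * (c s * (f (s ++ t) - mu s)))
                (fun s => c s * f (s ++ t) - c s * mu s)) in CS.
      2:{ intro s. rewrite <- Rmult_assoc, Hc. ring. }
      rewrite (expect_ext q m (fun s => c s * (f (s ++ t) - mu s) * (c s * (f (s ++ t) - mu s)))
                (fun s => c s * ((f (s ++ t) - mu s) * (f (s ++ t) - mu s)))) in CS.
      2:{ intro s. rewrite <- (Hc s) at 3. ring. }
      exact CS.
    - rewrite expect_scal. apply Rmult_le_compat_l; [lra|]. right.
      rewrite <- (expect_swap q m l (fun s t => c s * ((f (s ++ t) - mu s) * (f (s ++ t) - mu s)))).
      unfold V2. apply expect_ext; intro s. rewrite expect_scal.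
      rewrite variance_centered. reflexivity. }
  assert (HG : P * P * variance q l G <= 2 * (P * V2) + 2 * ((P - P * P) * V1)).
  { rewrite <- variance_scal.
    pose proof (variance_plus_le l H (fun t => P * G t - H t)) as HS.
    replace (variance q l (fun t => P * G t))
      with (variance q l (fun s => H s + (P * G s - H s))); [lra|].
    unfold variance.
    rewrite (expect_ext q l (fun s => H s + (P * G s - H s)) (fun t => P * G t)) by (intro; ring).
    rewrite (expect_ext q l (fun s => (H s + (P * G s - H s)) * (H s + (P * G s - H s)))
               (fun t => P * G t * (P * G t))) by (intro; ring).
    reflexivity. }
  (* After multiplication by [P], [HG] gives [V1] the coefficient
     [P * P + 2 * (P - P * P) = P * (2 - P)]. *)
  rewrite Hdec. apply Rmult_le_reg_l with P; [exact Hp|]. nra.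
Qed.

(** * Poincare inequalities and enlargement of the volume *)

Definition has_zero (s : list bool) : R := if existsb negb s then 1 else 0.

Lemma expect_has_zero a k :
  expect q (a + k) (fun s => has_zero (skipn a s)) = 1 - (1 - q) ^ k.
Proof.
  induction a as [|a IH]; simpl; [|rewrite IH; ring].
  induction k as [|k IH]; simpl; [unfold has_zero; simpl; ring|].
  unfold has_zero in *; simpl. rewrite expect_const, IH. ring.
Qed.

(** In a nonempty volume the least such [T] is the relaxation time, by [Trel_le] and
    [poincare_Trel]; this form avoids dividing by the variance. *)
Definition poincare (n : nat) (T : R) : Prop :=
  forall f, variance q n f <= T * dirichlet q n 1 f.

Lemma poincare_antimono n m T : (n <= m)%nat -> poincare m T -> poincare n T.
Proof.
  intros Hle HP f. specialize (HP (fun s => f (firstn n s))).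
  replace m with (n + (m - n))%nat in HP by lia.
  unfold variance in HP. rewrite dirichlet_firstn, (expect_firstn q n _ f) in HP.
  rewrite (expect_firstn q n _ (fun s => f s * f s)) in HP. exact HP.
Qed.

Lemma poincare_weaken n T T' : T <= T' -> poincare n T -> poincare n T'.
Proof.
  intros Hle HP f. specialize (HP f).
  pose proof (dirichlet_nonneg n 1 f ltac:(lra)). nra.
Qed.

(* Induction on [k] searches for the leftmost zero: once it is found, the
   Poincare inequality applies to everything on its right. *)
Lemma facilitated_variance_le k l T : 0 <= T ->
  (forall j, (j < k)%nat -> poincare (j + l) T) ->
  forall c f, 0 <= c ->
  expect q k (fun s => has_zero s * variance q l (fun t => f (s ++ t)))
  <= T * dirichlet q (k + l) c f.
Proof.
  intros HT. induction k as [|k IH]; intros HP c f Hc; simpl.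
  - unfold has_zero; simpl. pose proof (dirichlet_nonneg l c f Hc). nra.
  (* An occupied leftmost site blocks its neighbour, so the induction hypothesis is used with
     constraint value 0; hence the quantification over [c]. *)
  - pose proof (IH (fun j Hj => HP j (Nat.lt_lt_succ_r _ _ Hj)) 0
                  (fun s => f (true :: s)) ltac:(lra)) as H1.
    pose proof (HP k (Nat.lt_succ_diag_r k) (fun s => f (false :: s))) as H2.
    pose proof (variance_app_le k l (fun s => f (false :: s))) as H3.
    rewrite (expect_ext q k (fun s => has_zero (false :: s) * _)
              (fun s => variance q l (fun t => f (false :: s ++ t))))
      by (intro; unfold has_zero; simpl; ring).
    rewrite (expect_ext q k (fun s => has_zero (true :: s) * _)
              (fun s => has_zero s * variance q l (fun t => f (true :: s ++ t))))
      by (intro; unfold has_zero; simpl; ring).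
    set (D1 := dirichlet q (k + l) 1 (fun s => f (false :: s))) in *.
    set (D0 := dirichlet q (k + l) 0 (fun s => f (true :: s))) in *.
    match goal with |- _ <= T * (c * (q * (1 - q)) * ?e + _ + _) =>
      assert (He : 0 <= e) by (apply expect_nonneg; intro; apply Rle_0_sqr);
      set (E0 := e) in * end.
    assert (0 <= T * (c * (q * (1 - q)) * E0)).
    { apply Rmult_le_pos; [lra|]. apply Rmult_le_pos; [|exact He].
      apply Rmult_le_pos; [lra|]. apply Rmult_le_pos; lra. }
    apply Rle_trans with (q * (T * D1) + (1 - q) * (T * D0)); [|nra].
    apply Rplus_le_compat; apply Rmult_le_compat_l; lra.
Qed.

(** The first [a] sites only set the constraint value at the start of the window, and
    [facilitated_variance_le] allows any nonnegative one. Their own flip terms are nonnegative and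
    are dropped. *)
Lemma facilitated_variance_le_shift a k l T : 0 <= T ->
  (forall j, (j < k)%nat -> poincare (j + l) T) ->
  forall c f, 0 <= c ->
  expect q (a + k) (fun s => has_zero (skipn a s) * variance q l (fun t => f (s ++ t)))
  <= T * dirichlet q (a + k + l) c f.
Proof.
  intros HT HP. induction a as [|a IH]; intros c f Hc.
  - now apply facilitated_variance_le.
  - simpl.
    pose proof (IH 1 (fun s => f (false :: s)) ltac:(lra)) as H1.
    pose proof (IH 0 (fun s => f (true :: s)) ltac:(lra)) as H2. simpl in H1, H2.
    set (D1 := dirichlet q (a + k + l) 1 (fun s => f (false :: s))) in *.
    set (D0 := dirichlet q (a + k + l) 0 (fun s => f (true :: s))) in *.
    match goal with |- _ <= T * (c * (q * (1 - q)) * ?e + _ + _) =>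
      assert (He : 0 <= e) by (apply expect_nonneg; intro; apply Rle_0_sqr);
      set (E0 := e) in * end.
    assert (0 <= T * (c * (q * (1 - q)) * E0)).
    { apply Rmult_le_pos; [lra|]. apply Rmult_le_pos; [|exact He].
      apply Rmult_le_pos; [lra|]. apply Rmult_le_pos; lra. }
    apply Rle_trans with (q * (T * D1) + (1 - q) * (T * D0)); [|nra].
    apply Rplus_le_compat; apply Rmult_le_compat_l; lra.
Qed.

(** Here [j] counts the window sites to the right of the leftmost zero. The 4 bounds the sum
    [(2 - P) + 2] of the coefficients in [two_block_variance]. *)
Lemma poincare_two_block a k l T : 0 <= T -> (0 < k)%nat ->
  poincare (a + k) T -> (forall j, (j < k)%nat -> poincare (j + l) T) ->
  poincare (a + k + l) (4 / (1 - (1 - q) ^ k) * T).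
Proof.
  intros HT Hk HP1 HP2 f.
  set (c := fun s => has_zero (skipn a s)).
  assert (Hpow : 0 < (1 - q) ^ k < 1).
  { split; [apply pow_lt; lra|]. apply pow_lt_1_compat; [lra|lia]. }
  pose proof (expect_has_zero a k) as Hc.
  assert (Hcc : forall s, c s * c s = c s)
    by (intro s; unfold c, has_zero; destruct existsb; ring).
  pose proof (two_block_variance (a + k) l c f Hcc) as HV.
  unfold c in HV at 1 2 3. rewrite Hc in HV. specialize (HV ltac:(lra)).
  pose proof (facilitated_variance_le_shift a k l T HT HP2 1 f ltac:(lra)) as H2.
  fold c in H2.
  assert (H1 : expect q l (fun t => variance q (a + k) (fun s => f (s ++ t)))
               <= T * dirichlet q (a + k + l) 1 f).
  { apply Rle_trans with
      (expect q l (fun t => T * dirichlet q (a + k) 1 (fun s => f (s ++ t)))).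
    - apply expect_le; intro t. apply HP1.
    - rewrite expect_scal. apply Rmult_le_compat_l; [exact HT|].
      apply dirichlet_prefix_le; lra. }
  unfold c in H2.
  set (D := dirichlet q (a + k + l) 1 f) in *.
  assert (HD : 0 <= T * D) by (apply Rmult_le_pos; [exact HT|apply dirichlet_nonneg; lra]).
  set (P := 1 - (1 - q) ^ k) in *.
  assert (HP : 0 < P < 1) by (unfold P; lra).
  apply Rmult_le_reg_l with P; [lra|].
  replace (P * (4 / P * T * D)) with (4 * (T * D)) by (field; lra).
  set (V1 := expect q l (fun t => variance q (a + k) (fun s => f (s ++ t)))) in *.
  change (fun s => c s * _) with
    (fun s => has_zero (skipn a s) * variance q l (fun t => f (s ++ t))) in HV.
  assert ((2 - P) * V1 <= (2 - P) * (T * D)) by (apply Rmult_le_compat_l; lra).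
  nra.
Qed.

(** Only finiteness matters: it makes the gap positive. On one site the inequality is an equality
    with [T = 1], and a one-site first block then adds one site at a time. *)
Lemma poincare_exists n : exists T, 0 < T /\ poincare n T.
Proof.
  assert (P1 : poincare 1 1) by (intro f; unfold variance; simpl; right; ring).
  induction n as [|n [T [HT IH]]].
  - exists 1. split; [lra|]. now apply (poincare_antimono 0 1); [lia|].
  - set (M := Rmax 1 T).
    exists (4 / (1 - (1 - q) ^ 1) * M). split.
    + apply Rmult_lt_0_compat; [apply Rdiv_lt_0_compat; simpl; lra|].
      unfold M. pose proof (Rmax_l 1 T). lra.
    + apply (poincare_two_block 0 1 n).
      * unfold M. pose proof (Rmax_l 1 T). lra.
      * lia.
      * apply poincare_weaken with 1; [apply Rmax_l|exact P1].
      * intros j Hj. replace j with 0%nat by lia.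
        apply poincare_weaken with T; [apply Rmax_r|exact IH].
Qed.

Lemma poincare_iterate h N T : 0 <= T -> (0 < h)%nat -> poincare (h + h) T ->
  poincare (h + h + N * h) ((4 / (1 - (1 - q) ^ h)) ^ N * T).
Proof.
  intros HT Hh HP. set (K := 4 / (1 - (1 - q) ^ h)).
  assert (HK : 1 <= K).
  { assert (0 < (1 - q) ^ h < 1)
      by (split; [apply pow_lt; lra|apply pow_lt_1_compat; [lra|lia]]).
    unfold K. apply Rmult_le_reg_r with (1 - (1 - q) ^ h); [lra|].
    unfold Rdiv. rewrite Rmult_assoc, Rinv_l by lra. lra. }
  induction N as [|N IH]; simpl.
  - now rewrite Nat.add_0_r, Rmult_1_l.
  - assert (HKN : 1 <= K ^ N) by (apply pow_R1_Rle; exact HK).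
    (* The window is the last [h] sites of the volume already reached, and [h] new sites are
       appended. What lies right of a zero in the window has fewer than [h + h] sites, so the
       initial inequality serves in every round. *)
    replace (h + h + (h + N * h))%nat with ((h + N * h) + h + h)%nat by lia.
    rewrite Rmult_assoc. apply poincare_two_block.
    + nra.
    + exact Hh.
    + replace (h + N * h + h)%nat with (h + h + N * h)%nat by lia. exact IH.
    + intros j Hj. apply poincare_weaken with T; [nra|].
      apply poincare_antimono with (h + h)%nat; [lia|exact HP].
Qed.

End Positivity.

(** * Relaxation time as the optimal Poincare constant *)

Lemma piE_expect L q f : piE L q f = expect q L f.
Proof.
  revert f; induction L as [|L IH]; intro f.
  - unfold piE; simpl; ring.
  - simpl. rewrite <- !IH. unfold piE; simpl.
    induction (configs L) as [|s l IHl]; simpl; [ring|].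
    rewrite IHl. ring.
Qed.

Lemma piVar_variance L q f : piVar L q f = variance q L f.
Proof. unfold piVar, variance. now rewrite !piE_expect. Qed.

(** [cX] fixes the value 1 at the leftmost site; once that site is split off, its successor may
    carry 0, hence the parameter. *)
Definition constraint (c : R) (i : nat) (s : list bool) : R :=
  match i with O => c | S _ => cX i s end.

Lemma sumR_map_lin {A} a b (f g h : A -> R) l :
  (forall x, f x = a * g x + b * h x) ->
  sumR (map f l) = a * sumR (map g l) + b * sumR (map h l).
Proof.
  intro H. induction l as [|x l IH]; simpl; [ring|]. rewrite IH, H. ring.
Qed.

(** The local variance at the leftmost site is [q * (1 - q)] times a squared increment; the
    remaining sites form the same sum on the tail, with constraint value 1 or 0 according to the
    removed spin. *)
Lemma sum_dirichlet q L c f :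
  sumR (map (fun i => expect q L (fun s => constraint c i s * VarX q i f s)) (seq 0 L))
  = dirichlet q L c f.
Proof.
  revert c f; induction L as [|L IH]; intros c f; [reflexivity|].
  rewrite <- cons_seq, <- seq_shift, map_cons, map_map.
  change (sumR (?x :: ?l)) with (x + sumR l).
  rewrite (sumR_map_lin q (1 - q) _
    (fun i => expect q L (fun s => constraint 1 i s * VarX q i (fun t => f (false :: t)) s))
    (fun i => expect q L (fun s => constraint 0 i s * VarX q i (fun t => f (true :: t)) s))).
  - rewrite !IH.
    change (dirichlet q (S L) c f) with
      (c * (q * (1 - q)) *
        expect q L (fun s => (f (true :: s) - f (false :: s)) *
                             (f (true :: s) - f (false :: s)))
      + q * dirichlet q L 1 (fun s => f (false :: s))
      + (1 - q) * dirichlet q L 0 (fun s => f (true :: s))).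
    rewrite <- expect_scal. rewrite Rplus_assoc. f_equal.
    simpl. rewrite <- expect_lin. apply expect_ext; intro s.
    unfold VarX, piX; simpl. ring.
  - intro i. destruct i; reflexivity.
Qed.

Lemma Dir_dirichlet L q f : Dir L q f = dirichlet q L 1 f.
Proof.
  rewrite <- sum_dirichlet. unfold Dir. f_equal. apply map_ext; intro i.
  rewrite piE_expect. apply expect_ext; intro s. destruct i; reflexivity.
Qed.

Lemma exists_variance_pos q L : 0 < q < 1 -> (0 < L)%nat ->
  exists f, 0 < variance q L f.
Proof.
  intros Hq HL. destruct L as [|L]; [lia|].
  exists (fun s => if hd false s then 1 else 0).
  unfold variance; simpl. rewrite !expect_const. nra.
Qed.

(** [epsilon] is meaningful only once an infimum exists; it is minus the supremum of the reflected
    set. In the empty volume all variances vanish and [gap_set] is empty, hence [0 < L]. *)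
Lemma gap_is_glb q L : 0 < q < 1 -> (0 < L)%nat -> is_glb (gap_set L q) (gap L q).
Proof.
  intros Hq HL. unfold gap. apply epsilon_spec.
  destruct (completeness (fun x => gap_set L q (- x))) as [m [Hub Hlub]].
  - exists 0. intros x [f [Hv Hx]]. rewrite Dir_dirichlet in Hx.
    pose proof (dirichlet_nonneg q Hq L 1 f ltac:(lra)) as Hd.
    assert (0 <= dirichlet q L 1 f / piVar L q f)
      by (apply Rmult_le_pos; [exact Hd|left; now apply Rinv_0_lt_compat]).
    lra.
  - destruct (exists_variance_pos q L Hq HL) as [f Hf].
    exists (- (Dir L q f / piVar L q f)), f. rewrite Ropp_involutive.
    split; [now rewrite piVar_variance|reflexivity].
  - exists (- m). split.
    + intros r Hr. rewrite <- (Ropp_involutive r) in Hr.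
      specialize (Hub _ Hr). lra.
    + intros b Hb. assert (m <= - b); [|lra].
      apply Hlub. intros x Hx. specialize (Hb _ Hx). lra.
Qed.

Lemma gap_ge_inv q L T : 0 < q < 1 -> (0 < L)%nat -> 0 < T ->
  poincare q L T -> / T <= gap L q.
Proof.
  intros Hq HL HT HP. destruct (gap_is_glb q L Hq HL) as [_ Hg]. apply Hg.
  intros r [f [Hv ->]]. rewrite Dir_dirichlet, piVar_variance in *.
  specialize (HP f). apply Rmult_le_reg_r with (variance q L f); [exact Hv|].
  unfold Rdiv. rewrite Rmult_assoc, Rinv_l by lra.
  apply Rmult_le_reg_l with T; [exact HT|].
  rewrite <- Rmult_assoc, Rinv_r by lra. lra.
Qed.

Lemma gap_pos q L : 0 < q < 1 -> (0 < L)%nat -> 0 < gap L q.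
Proof.
  intros Hq HL. destruct (poincare_exists q Hq L) as [T [HT HP]].
  pose proof (gap_ge_inv q L T Hq HL HT HP). pose proof (Rinv_0_lt_compat T HT). lra.
Qed.

Lemma Trel_pos q L : 0 < q < 1 -> (0 < L)%nat -> 0 < Trel L q.
Proof. intros. apply Rdiv_lt_0_compat; [lra|now apply gap_pos]. Qed.

Lemma Trel_le q L T : 0 < q < 1 -> (0 < L)%nat -> 0 < T ->
  poincare q L T -> Trel L q <= T.
Proof.
  intros Hq HL HT HP. pose proof (gap_ge_inv q L T Hq HL HT HP) as H.
  unfold Trel, Rdiv. rewrite Rmult_1_l, <- (Rinv_inv T).
  apply Rinv_le_contravar; [now apply Rinv_0_lt_compat|exact H].
Qed.

Lemma poincare_Trel q L : 0 < q < 1 -> (0 < L)%nat -> poincare q L (Trel L q).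
Proof.
  intros Hq HL f. pose proof (gap_pos q L Hq HL) as Hg.
  destruct (gap_is_glb q L Hq HL) as [Hlb _].
  pose proof (dirichlet_nonneg q Hq L 1 f ltac:(lra)) as Hd.
  pose proof (Trel_pos q L Hq HL).
  destruct (Rle_lt_or_eq_dec _ _ (variance_nonneg q Hq L f)) as [Hv|Hv].
  2:{ rewrite <- Hv. apply Rmult_le_pos; lra. }
  specialize (Hlb (dirichlet q L 1 f / variance q L f)).
  assert (Hle : gap L q <= dirichlet q L 1 f / variance q L f).
  { apply Hlb. exists f. rewrite Dir_dirichlet, piVar_variance. now split. }
  apply Rmult_le_compat_r with (r := variance q L f) in Hle; [|lra].
  unfold Rdiv in Hle. rewrite Rmult_assoc, Rinv_l in Hle by lra.
  unfold Trel, Rdiv. apply Rmult_le_reg_l with (gap L q); [exact Hg|].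
  rewrite Rmult_1_l, <- Rmult_assoc, Rinv_r by lra. lra.
Qed.

(** * Volumes of order [1/q] *)

Lemma nfloor_bounds x : 0 <= x -> INR (nfloor x) <= x < INR (nfloor x) + 1.
Proof.
  intro Hx. unfold nfloor. destruct (base_Int_part x) as [H1 H2].
  assert (0 <= Int_part x)%Z.
  { apply Z.lt_succ_r, lt_IZR. rewrite succ_IZR. simpl. lra. }
  rewrite INR_IZR_INZ, Z2Nat.id by assumption. lra.
Qed.

Lemma pow_one_minus_le_exp q n : 0 < q < 1 -> (1 - q) ^ n <= exp (- (q * INR n)).
Proof.
  intro Hq. induction n as [|n IH].
  - simpl. rewrite Rmult_0_r, Ropp_0, exp_0. lra.
  - rewrite S_INR. replace (- (q * (INR n + 1))) with (- q + - (q * INR n)) by ring.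
    rewrite exp_plus. simpl. apply Rmult_le_compat; try lra.
    + apply pow_le; lra.
    + pose proof (exp_ineq1_le (- q)). lra.
Qed.

Lemma Trel_ratio_le d d' : 0 < d -> 0 < d' ->
  exists C delta, 0 < C /\ 0 < delta /\
    forall q, 0 < q < delta -> q < 1/2 ->
      0 < Trel (nfloor (d / q)) q /\ 0 < Trel (nfloor (d' / q)) q /\
      Trel (nfloor (d' / q)) q <= C * Trel (nfloor (d / q)) q.
Proof.
  intros Hd Hd'.
  (* With [h >= d / (4 * q)], [N >= 4 * d' / d] steps of length [h] cover [d' / q]. *)
  set (N := S (nfloor (4 * d' / d))).
  (* Free of [q]: it dominates the two-block constant, since [(1 - q) ^ h <= exp (- (d / 4))] when
     [q * h >= d / 4]. *)
  set (K := 4 / (1 - exp (- (d / 4)))).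
  assert (Hexp : exp (- (d / 4)) < 1) by (rewrite <- exp_0; apply exp_increasing; lra).
  assert (HK : 0 < K) by (apply Rdiv_lt_0_compat; lra).
  exists (K ^ N), (Rmin (d / 4) d').
  split; [now apply pow_lt|]. split; [apply Rmin_pos; lra|].
  intros q [Hq0 Hqd] Hq2. assert (Hq : 0 < q < 1) by lra.
  assert (Hq4 : q < d / 4) by (eapply Rlt_le_trans; [exact Hqd|apply Rmin_l]).
  assert (Hq' : q < d') by (eapply Rlt_le_trans; [exact Hqd|apply Rmin_r]).
  assert (Hx : 0 <= d / q) by (left; apply Rdiv_lt_0_compat; lra).
  assert (Hx' : 0 <= d' / q) by (left; apply Rdiv_lt_0_compat; lra).
  destruct (nfloor_bounds _ Hx) as [B1 B2]. destruct (nfloor_bounds _ Hx') as [B1' B2'].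
  set (L := nfloor (d / q)) in *. set (L' := nfloor (d' / q)) in *.
  assert (Hbig : 4 < d / q).
  { apply Rmult_lt_reg_r with q; [lra|]. unfold Rdiv. rewrite Rmult_assoc, Rinv_l by lra. lra. }
  assert (Hbig' : 1 < d' / q).
  { apply Rmult_lt_reg_r with q; [lra|]. unfold Rdiv. rewrite Rmult_assoc, Rinv_l by lra. lra. }
  assert (HL : (0 < L)%nat) by (apply INR_lt; simpl; lra).
  assert (HL' : (0 < L')%nat) by (apply INR_lt; simpl; lra).
  pose proof (Trel_pos q L Hq HL) as HT. pose proof (Trel_pos q L' Hq HL') as HT'.
  split; [exact HT|]. split; [exact HT'|].
  set (h := (L / 2)%nat).
  assert (Hh1 : (h + h <= L)%nat /\ (L <= h + h + 1)%nat).
  { pose proof (Nat.div_mod L 2 ltac:(lia)). pose proof (Nat.mod_upper_bound L 2 ltac:(lia)).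
    fold h in H. lia. }
  destruct Hh1 as [Hh1 Hh2].
  assert (Hh2R : INR L <= INR h + INR h + 1).
  { apply le_INR in Hh2. rewrite !plus_INR in Hh2. simpl in Hh2. lra. }
  (* The floor and the halving cost at most 1 in [d / q / 2 - h], which [d / q > 4] absorbs. *)
  assert (Hh : d / q / 4 <= INR h) by lra.
  assert (Hh0 : (0 < h)%nat) by (apply INR_lt; simpl; lra).
  assert (Hqh : d / 4 <= q * INR h).
  { replace (d / 4) with (q * (d / q / 4)) by (field; lra).
    apply Rmult_le_compat_l; lra. }
  assert (Hpow : (1 - q) ^ h <= exp (- (d / 4))).
  { eapply Rle_trans; [now apply pow_one_minus_le_exp|].
    destruct (Rle_lt_or_eq_dec _ _ Hqh) as [Hlt|Heq].
    - left; apply exp_increasing; lra.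
    - rewrite Heq; lra. }
  assert (Hpow0 : 0 < (1 - q) ^ h) by (apply pow_lt; lra).
  set (K' := 4 / (1 - (1 - q) ^ h)).
  assert (HK' : 0 < K' <= K).
  { unfold K', K. split; [apply Rdiv_lt_0_compat; lra|].
    unfold Rdiv. apply Rmult_le_compat_l; [lra|]. apply Rinv_le_contravar; lra. }
  assert (HP : poincare q (h + h + N * h) (K' ^ N * Trel L q)).
  { apply poincare_iterate; try assumption; [lra|].
    apply poincare_antimono with L; [exact Hh1|now apply poincare_Trel]. }
  assert (HLL : (L' <= h + h + N * h)%nat).
  { apply INR_le. rewrite !plus_INR, mult_INR.
    apply Rle_trans with (INR N * INR h); [|pose proof (pos_INR h); lra].
    eapply Rle_trans; [exact B1'|].
    assert (HN : 4 * d' / d <= INR N).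
    { unfold N. rewrite S_INR.
      destruct (nfloor_bounds (4 * d' / d)); [left; apply Rdiv_lt_0_compat|]; lra. }
    replace (d' / q) with ((4 * d' / d) * (d / q / 4)) by (field; lra).
    apply Rmult_le_compat; try lra.
    left; apply Rdiv_lt_0_compat; lra. }
  apply Rle_trans with (K' ^ N * Trel L q).
  - apply Trel_le; [exact Hq|exact HL'| |].
    + apply Rmult_lt_0_compat; [apply pow_lt; lra|exact HT].
    + now apply poincare_antimono with (h + h + N * h)%nat.
  - apply Rmult_le_compat_r; [lra|]. apply pow_incr; lra.
Qed.

Lemma Trel_ratio_bounds d d' : 0 < d -> 0 < d' ->
  exists c C delta : R, 0 < c /\ 0 < delta /\
    forall q : R, 0 < q < delta -> q < 1/2 ->
      c <= Trel (nfloor (d / q)) q / Trel (nfloor (d' / q)) q <= C.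
Proof.
  intros Hd Hd'.
  destruct (Trel_ratio_le d d' Hd Hd') as [C1 [e1 [HC1 [He1 H1]]]].
  destruct (Trel_ratio_le d' d Hd' Hd) as [C2 [e2 [HC2 [He2 H2]]]].
  (* [Trel_ratio_le] assumes no order between [d] and [d']; exchanging them gives the other side of
     the bound. *)
  exists (/ C1), C2, (Rmin e1 e2).
  split; [now apply Rinv_0_lt_compat|]. split; [now apply Rmin_pos|].
  intros q [Hq0 Hqd] Hq2.
  pose proof (Rmin_l e1 e2). pose proof (Rmin_r e1 e2).
  destruct (H1 q ltac:(lra) Hq2) as [P1 [P2 B1]].
  destruct (H2 q ltac:(lra) Hq2) as [_ [_ B2]].
  set (T := Trel (nfloor (d / q)) q) in *. set (T' := Trel (nfloor (d' / q)) q) in *.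
  split; apply Rmult_le_reg_r with T'; try exact P2;
    unfold Rdiv; rewrite ?(Rmult_assoc T), ?Rinv_l by lra; [|lra].
  apply Rmult_le_reg_l with C1; [exact HC1|].
  rewrite <- Rmult_assoc, Rinv_r by lra. lra.
Qed.

(** * From bounded ratios to the limit on the logarithmic scale *)

Lemma exp_near_0 eps : 0 < eps ->
  exists eta, 0 < eta /\ forall y, Rabs y < eta -> Rabs (exp y - 1) < eps.
Proof.
  intro He.
  destruct (derivable_continuous_pt exp 0 (derivable_pt_exp 0) eps He) as [eta [Heta H]].
  exists eta. split; [exact Heta|]. intros y Hy.
  (* The limit defining continuity excludes the point 0 itself. *)
  destruct (Req_dec y 0) as [->|Hy0].
  - rewrite exp_0, Rminus_diag, Rabs_R0. exact He.
  - rewrite <- exp_0. apply (H y). split.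
    + split; [exact I|]. congruence.
    + simpl. unfold Rdist. now rewrite Rminus_0_r.
Qed.

Lemma ln_le_compat x y : 0 < x -> x <= y -> ln x <= ln y.
Proof.
  intros Hx [H|H]; [left; now apply ln_increasing|rewrite H; apply Rle_refl].
Qed.

Theorem mainTheorem4 :
  (forall d d' : R, 0 < d -> 0 < d' ->
     exists c C delta : R, 0 < c /\ 0 < delta /\
       forall q : R, 0 < q < delta -> q < 1/2 ->
         c <= Trel (nfloor (d / q)) q / Trel (nfloor (d' / q)) q <= C)
  /\
  (forall d d' : R, 0 < d < d' ->
     forall eps : R, 0 < eps ->
       exists delta : R, 0 < delta /\
         forall q : R, 0 < q < delta -> q < 1/2 ->
           Rabs (Rpower (Trel (nfloor (d' / q)) q / Trel (nfloor (d / q)) q)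
                        (1 / ln (1 / q)) - 1) < eps).
Proof.
  split; [exact Trel_ratio_bounds|].
  intros d d' [Hd Hdd] eps Heps.
  destruct (Trel_ratio_bounds d' d ltac:(lra) Hd) as [c [C [e [Hc [He H]]]]].
  destruct (exp_near_0 eps Heps) as [eta [Heta Hexp]].
  (* A strict bound for the absolute value of [ln r] whenever [c <= r <= C]; the 1 also makes it
     positive. *)
  set (M := Rabs (ln c) + Rabs (ln C) + 1).
  assert (HM : 0 < M) by (unfold M; pose proof (Rabs_pos (ln c)); pose proof (Rabs_pos (ln C)); lra).
  assert (HMe : 0 < M / eta) by (apply Rdiv_lt_0_compat; lra).
  (* For [q < exp (- (M / eta))] one has [ln (1 / q) > M / eta], so the exponent [ln r / ln (1 / q)]
     is smaller than [eta] in absolute value. *)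
  exists (Rmin e (exp (- (M / eta)))).
  split; [apply Rmin_pos; [exact He|apply exp_pos]|].
  intros q [Hq0 Hqd] Hq2.
  pose proof (Rmin_l e (exp (- (M / eta)))). pose proof (Rmin_r e (exp (- (M / eta)))).
  specialize (H q ltac:(lra) Hq2).
  set (r := Trel (nfloor (d' / q)) q / Trel (nfloor (d / q)) q) in *.
  assert (Hln : M / eta < ln (1 / q)).
  { unfold Rdiv at 2. rewrite Rmult_1_l, ln_Rinv by exact Hq0.
    assert (Hl : ln q < - (M / eta)); [|lra].
    rewrite <- (ln_exp (- (M / eta))). apply ln_increasing; lra. }
  assert (Hr : Rabs (ln r) < M).
  { assert (ln c <= ln r) by (apply ln_le_compat; lra).
    assert (ln r <= ln C) by (apply ln_le_compat; lra).
    unfold M. apply Rabs_def1.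
    - pose proof (Rle_abs (ln C)). pose proof (Rabs_pos (ln c)). lra.
    - pose proof (Rle_abs (- ln c)). rewrite Rabs_Ropp in *.
      pose proof (Rabs_pos (ln C)). lra. }
  unfold Rpower. apply Hexp.
  rewrite Rabs_mult, (Rabs_right (1 / ln (1 / q))).
  2:{ apply Rle_ge. left. apply Rdiv_lt_0_compat; lra. }
  apply Rmult_lt_reg_l with (ln (1 / q)); [lra|].
  rewrite <- Rmult_assoc. unfold Rdiv at 2. rewrite Rmult_1_l, Rinv_r by lra.
  apply Rmult_lt_compat_r with (r := eta) in Hln; [|exact Heta].
  unfold Rdiv in Hln at 1. rewrite Rmult_assoc, Rinv_l in Hln by lra. lra.
Qed.
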